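(* Let $G$ be a graded digraph with graded partition $V(G)=V_1\cup\dots\cup V_H$ for some $H\in\mathbb N$, with maximum in-degree $\Delta^-$ and maximum out-degree $\Delta^+$. For each $i\in[H-1]$ let $\Delta_i^-$ be the maximum in-degree in the induced subgraph $G[V_i\cup V_{i+1}]$, and set $\Delta_0^-=\Delta_H^-=0$. Then \[ \vec r(G)\leq 10^9(\Delta^-)^2\Delta^+\sum_{i=1}^H 2^{2(\Delta_{i-1}^-+\Delta_i^-)}|V_i|. \]
   Context: A digraph $G$ is graded with graded partition $V(G)=V_1\cup\dots\cup V_H$ if every edge is directed from $V_i$ to $V_{i+1}$ for some $i\in[H-1]$. A tournament is an orientation of a complete graph; for an acyclic digraph $G$, $\vec r(G)$ is the smallest $N$ such that every tournament on $N$ vertices contains a copy of $G$.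
   Formalization: The theorem additionally assumes that G has at least one edge; for an edgeless nonempty G the maximum degrees are 0, so the right-hand side is 0 while the oriented Ramsey number is |V(G)| > 0 and the inequality fails. *)

(* Defs.v *)
From mathcomp Require Import all_boot.

Set Implicit Arguments.
Unset Strict Implicit.
Unset Printing Implicit Defensive.

(* A finite digraph is a relation [e : rel V] on a finite type: [e u v] means
   that there is an edge directed from [u] to [v]. *)

Definition in_degree (V : finType) (e : rel V) (v : V) : nat :=
  #|[set u | e u v]|.

Definition out_degree (V : finType) (e : rel V) (v : V) : nat :=
  #|[set u | e v u]|.

Definition max_in_degree (V : finType) (e : rel V) : nat :=
  \max_(v : V) in_degree e v.

Definition max_out_degree (V : finType) (e : rel V) : nat :=
  \max_(v : V) out_degree e v.

Definition induced (V : finType) (e : rel V) (S : {set V}) :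
    rel {x : V | x \in S} :=
  fun x y => e (val x) (val y).
Arguments induced {V} e S x y.

(* Parts are indexed from 1 to [H]; the values of [P] outside this range are
   irrelevant. Parts are allowed to be empty. *)
Definition graded_partition (V : finType) (e : rel V) (H : nat)
    (P : nat -> {set V}) : Prop :=
  [/\ forall v : V, exists2 i, 1 <= i <= H & v \in P i,
      forall i j, 1 <= i <= H -> 1 <= j <= H -> i <> j -> [disjoint P i & P j]
    & forall u v : V, e u v ->
        exists2 i, 1 <= i < H & u \in P i /\ v \in P i.+1].

Definition layer_max_in_degree (V : finType) (e : rel V) (H : nat)
    (P : nat -> {set V}) (i : nat) : nat :=
  if 1 <= i < H then max_in_degree (induced e (P i :|: P i.+1)) else 0.

Definition tournament (T : finType) (t : rel T) : Prop :=
  irreflexive t /\ forall x y : T, x != y -> t x y = ~~ t y x.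

(* Copies are not required to be induced. *)
Definition contains_copy (V T : finType) (e : rel V) (t : rel T) : Prop :=
  exists2 f : V -> T, injective f & forall u v : V, e u v -> t (f u) (f v).

Definition unavoidable_at (V : finType) (e : rel V) (N : nat) : Prop :=
  forall (T : finType) (t : rel T), #|T| = N -> tournament t ->
    contains_copy e t.

(* [is_oriented_ramsey e r] states that the oriented Ramsey number of [e]
   exists and equals [r]. *)
Definition is_oriented_ramsey (V : finType) (e : rel V) (r : nat) : Prop :=
  unavoidable_at e r /\ forall N, unavoidable_at e N -> r <= N.

(* Main.v *)
From Stdlib Require Import Classical.
Require Import Defs.
From mathcomp Require Import all_boot zify.

(* Take a median order of the tournament: each vertex receives edges from at
   least half of any interval of the order that ends just before it. Walking
   down through the layers from H to 1, one finds sets B_H, ..., B_1, each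
   inside an interval of the order: since the interval preceding B_{i+1} is
   long, some chunk of it sends density almost 1/2 to B_{i+1}, and dependent
   random choice with k_i samples from B_{i+1} extracts from that chunk a set
   B_i in which very few s_i-tuples have fewer than 2^-a_i |B_{i+1}| common
   out-neighbours in B_{i+1}; here s_i is the maximum in-degree from layer i to
   layer i+1. The layers are then embedded in increasing order: a vertex of
   layer i is sent to a random element of the common out-neighbourhood in B_i
   of the images of its in-neighbours, which has density at least 2^-a_{i-1},
   and the local lemma avoids collisions and bad tuples.

   Restricting to such lists multiplies the density of bad tuples by up to
   2^(s_i a_{i-1}), so the k_i and a_i must satisfy a recursive inequality. It
   is solved by a_i = s_i + min(s_i, s_{i-1}) + 2 and
   k_i = max(2 s_i + d, a_{i-1}), with 2^d about 8 Delta^+. When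
   k_i = a_{i-1} > 2 s_i + d, the cost of layer i is charged to layer i - 1, as
   layer i has at most Delta^+ |V_{i-1}| vertices which are not sources. If
   Delta^+ is exponentially large in Delta^-, constant k_i and a_i suffice. *)

Set Implicit Arguments.
Unset Strict Implicit.
Unset Printing Implicit Defensive.

(** * Median orders *)

Section MedianOrder.
Variables (T : finType) (r : rel T).

Fixpoint forward_edges (s : seq T) : nat :=
  if s is x :: s' then count (r x) s' + forward_edges s' else 0.

Definition crossing (s1 s2 : seq T) : nat := \sum_(x <- s1) count (r x) s2.

Lemma forward_edges_cat s1 s2 :
  forward_edges (s1 ++ s2) =
  forward_edges s1 + forward_edges s2 + crossing s1 s2.
Proof.
rewrite /crossing; elim: s1 => [|x s1 IH] /=; first by rewrite big_nil; lia.
by rewrite big_cons IH count_cat; lia.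
Qed.

Lemma crossing_catr s s1 s2 :
  crossing s (s1 ++ s2) = crossing s s1 + crossing s s2.
Proof.
by rewrite /crossing -big_split; apply: eq_bigr => x _; rewrite count_cat.
Qed.

Lemma crossing1l y s : crossing [:: y] s = count (r y) s.
Proof. by rewrite /crossing big_seq1. Qed.

Lemma crossing1r y s : crossing s [:: y] = count (r^~ y) s.
Proof.
by rewrite /crossing; elim: s => [|x s IH]; rewrite ?big_nil ?big_cons //= IH addn0.
Qed.

(** Take an ordering with the most forward edges. Moving [y] in front of [mid] only exchanges the
    edges from [mid] to [y] for those from [y] to [mid], so by maximality the former are at least
    half of [size mid]. *)
Lemma median_order : tournament r ->
  exists o : seq T, [/\ uniq o, size o = #|T| &
    forall pre mid y post, o = pre ++ mid ++ y :: post ->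
      size mid <= 2 * count (r^~ y) mid].
Proof.
case=> _ rP.
pose ok n := has (fun s => forward_edges s == n) (permutations (enum T)).
have ex_ok : exists n, ok n.
  exists (forward_edges (enum T)); apply/hasP; exists (enum T) => //.
  by rewrite mem_permutations.
have ub_ok n : ok n -> n <= \sum_(s <- permutations (enum T)) forward_edges s.
  by case/hasP => s sin /eqP <-; rewrite (big_rem s) //=; lia.
case: (ex_maxnP ex_ok ub_ok) => n /hasP [o oin /eqP fo] maxn.
move: oin; rewrite mem_permutations => po.
have uo : uniq o by rewrite (perm_uniq po) enum_uniq.
exists o; split=> //; first by rewrite (perm_size po) cardE.
move=> pre mid y post oE.
have po' : perm_eq (pre ++ y :: mid ++ post) (enum T).
  apply: perm_trans po; rewrite oE perm_cat2l -[y :: post]cat1s.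
  by rewrite -[y :: _]cat1s !catA perm_cat2r perm_catC.
have : ok (forward_edges (pre ++ y :: mid ++ post)).
  by apply/hasP; exists (pre ++ y :: mid ++ post) => //; rewrite mem_permutations.
move/maxn; rewrite -fo oE -[y :: post]cat1s -[y :: _ ++ _]cat1s.
rewrite !forward_edges_cat !crossing_catr !crossing1l !crossing1r /=.
have countC : count (r y) mid + count (r^~ y) mid = size mid.
  have : y \notin mid.
    move: uo; rewrite oE cat_uniq => /and3P [_ _]; rewrite cat_uniq => /and3P [_].
    by rewrite /= negb_or => /andP [].
  elim: (mid) => [|x s IH] //=; rewrite inE negb_or => /andP [nyx /IH <-].
  by move: (rP y x nyx) => ->; case: (r x y) => /=; lia.
lia.
Qed.

End MedianOrder.

(** * The local lemma *)

Section LocalLemma.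
Variables (V T : finType) (F : V -> {set T}) (J : finType).
Variables (E : J -> {set {ffun V -> T}}) (dep : J -> {set V}).

Definition avoid (S : {set J}) : {set {ffun V -> T}} :=
  [set f | (f \in family (fun v => mem (F v))) && [forall j in S, f \notin E j]].

Definition determined (D : {set V}) (X : {set {ffun V -> T}}) :=
  forall f g : {ffun V -> T}, {in D, f =1 g} -> (f \in X) = (g \in X).

Hypothesis E_dep : forall j, determined (dep j) (E j).

Lemma avoid0P (f : {ffun V -> T}) : reflect (forall v, f v \in F v) (f \in avoid set0).
Proof.
rewrite inE; apply: (iffP andP) => [[/familyP Ff _] v|Ff]; first exact: Ff.
split; first exact/familyP.
by apply/forall_inP => j; rewrite inE.
Qed.

Lemma avoidP (S : {set J}) (f : {ffun V -> T}) :
  reflect (f \in avoid set0 /\ forall j, j \in S -> f \notin E j) (f \in avoid S).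
Proof.
apply: (iffP idP) => [|[/avoid0P Ff nE]].
  rewrite inE => /andP [/familyP Ff /forall_inP nE]; split=> //.
  by apply/avoid0P => v; apply: Ff.
by rewrite inE; apply/andP; split; [apply/familyP => v; apply: Ff | apply/forall_inP].
Qed.

(* Swapping the coordinates in [dep j] between a point of [E j :&: avoid S] and
   an arbitrary point is injective, and decouples the two conditions. *)
Lemma card_indep j (S : {set J}) :
  (forall k, k \in S -> [disjoint dep k & dep j]) ->
  #|E j :&: avoid S| * #|avoid set0| <= #|E j :&: avoid set0| * #|avoid S|.
Proof.
move=> dS; rewrite -!cardsX.
pose mix (f g : {ffun V -> T}) : {ffun V -> T} :=
  [ffun v => if v \in dep j then f v else g v].
pose phi (p : {ffun V -> T} * {ffun V -> T}) := (mix p.1 p.2, mix p.2 p.1).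
have phiK : involutive phi.
  have mixK f g : mix (mix f g) (mix g f) = f.
    by apply/ffunP => v; rewrite !ffunE; case: ifP => ->.
  by case=> f g; rewrite /phi /= !mixK.
have mixF f g : f \in avoid set0 -> g \in avoid set0 -> mix f g \in avoid set0.
  by move=> /avoid0P Ff /avoid0P Fg; apply/avoid0P => v; rewrite ffunE; case: ifP.
rewrite -(card_imset _ (inv_inj phiK)); apply/subset_leq_card/subsetP => q.
case/imsetP => -[f g]; rewrite inE => /andP [/= /setIP [fE /avoidP [fF fS]] gF] ->.
rewrite inE /=; apply/andP; split.
  rewrite inE mixF // andbT (@E_dep j _ f) // => v vj.
  by rewrite ffunE vj.
apply/avoidP; split; first exact: mixF.
move=> k kS; rewrite (@E_dep k _ f) ?fS // => v vk.
by rewrite ffunE (disjointFr (dS k kS) vk).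
Qed.

Variables (M kappa : nat) (c : J -> nat).
Hypothesis (M_gt0 : 0 < M) (kappa_gt0 : 0 < kappa).
Hypothesis F_gt0 : 0 < #|avoid set0|.
Hypothesis dep_gt0 : forall j, 0 < #|dep j| <= kappa.
Hypothesis E_prob : forall j, M * #|E j :&: avoid set0| <= c j * #|avoid set0|.
Hypothesis c_sum : forall v, 4 * kappa * (\sum_(j | v \in dep j) c j) <= M.

(** Conditional probabilities, as ratios of cardinals: given that the events in [S] fail, [E j] has
    probability at most twice [c j / M]. Split [S] into the part [S2] independent of [j] and the
    rest [S1]. Independence handles [S2]; by induction and [c_sum] the events in [S1] remove at most
    half of [avoid S2]. *)
Lemma local_lemma_cond (S : {set J}) j : j \notin S ->
  M * #|E j :&: avoid S| <= 2 * c j * #|avoid S|.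
Proof.
elim: {S}_.+1 {-2}S (ltnSn #|S|) j => // n IH S leSn j jS.
pose S2 := [set k in S | [disjoint dep k & dep j]].
pose S1 := S :\: S2.
have S2S : S2 \subset S by apply/subsetP => k; rewrite inE => /andP [].
have avS : avoid S \subset avoid S2.
  apply/subsetP => f /avoidP [fF fS]; apply/avoidP; split=> // k kS2.
  exact: fS (subsetP S2S _ kS2).
have le1 : M * #|E j :&: avoid S| <= c j * #|avoid S2|.
  have le2 : #|E j :&: avoid S| <= #|E j :&: avoid S2|.
    exact/subset_leq_card/setIS.
  apply: leq_trans (leq_mul (leqnn M) le2) _; rewrite -(leq_pmul2r F_gt0).
  have /card_indep : forall k, k \in S2 -> [disjoint dep k & dep j].
    by move=> k; rewrite inE => /andP [].
  have := E_prob j; nia.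
suff le2 : #|avoid S2| <= 2 * #|avoid S| by nia.
have cover : #|avoid S2| <= #|avoid S| + \sum_(k in S1) #|E k :&: avoid S2|.
  have sub : avoid S2 \subset avoid S :|: \bigcup_(k in S1) (E k :&: avoid S2).
    apply/subsetP => f fS2; rewrite inE; case: (boolP (f \in avoid S)) => //= nfS.
    move: (fS2) => /avoidP [fF nE2].
    have : ~~ [forall k in S, f \notin E k].
      apply: contra nfS => /forall_inP nE; exact/avoidP.
    rewrite negb_forall => /existsP [k]; rewrite negb_imply negbK => /andP [kS fk].
    apply/bigcupP; exists k; last by rewrite inE fk.
    by rewrite inE kS andbT; apply: contraL fk; apply: nE2.
  apply: leq_trans (subset_leq_card sub) _.
  apply: leq_trans (leq_card_setU _ _) _; rewrite leq_add2l.
  elim/big_ind2: _ => [|m1 A1 m2 A2 le1' le2'|k _]; rewrite ?cards0 //.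
  exact: leq_trans (leq_card_setU _ _) (leq_add le1' le2').
have bnd : M * (\sum_(k in S1) #|E k :&: avoid S2|)
    <= (\sum_(k in S1) 2 * c k) * #|avoid S2|.
  rewrite big_distrr big_distrl /=; apply: leq_sum => k kS1.
  apply: IH; last by move: kS1; rewrite inE => /andP [].
  rewrite ltnS in leSn; apply: leq_trans leSn.
  by apply: proper_card; rewrite properE S2S; apply/subsetPn; exists k;
     move: kS1; rewrite inE => /andP [].
have sumc : \sum_(k in S1) c k <= \sum_(v in dep j) \sum_(k | v \in dep k) c k.
  rewrite (exchange_big_dep predT) //= big_mkcond /=; apply: leq_sum => k _.
  case: ifP => // kS1; have : ~~ [disjoint dep k & dep j].
    by move: kS1; rewrite !inE => /andP [nd kS]; rewrite kS in nd.
  rewrite -setI_eq0 => /set0Pn [v]; rewrite inE => /andP [vk vj].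
  rewrite (bigD1 v) /=; last by rewrite vj.
  by rewrite leq_addr.
have sumd : 4 * kappa * (\sum_(v in dep j) \sum_(k | v \in dep k) c k) <= kappa * M.
  apply: (@leq_trans (#|dep j| * M)).
    rewrite big_distrr -sum_nat_const /=; apply: leq_sum => v _; exact: c_sum.
  by rewrite leq_mul2r; case/andP: (dep_gt0 j) => _ ->; rewrite orbT.
have sum4 : 4 * (\sum_(k in S1) c k) <= M.
  rewrite -(leq_pmul2l kappa_gt0) mulnA [kappa * 4]mulnC; apply: leq_trans sumd.
  by rewrite leq_mul2l sumc orbT.
have sum2 : \sum_(k in S1) 2 * c k = 2 * \sum_(k in S1) c k by rewrite big_distrr.
rewrite sum2 in bnd.
have cov : M * #|avoid S2| <= M * (#|avoid S| + \sum_(k in S1) #|E k :&: avoid S2|).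
  by rewrite leq_mul2l cover orbT.
have : 4 * (\sum_(k in S1) c k) * #|avoid S2| <= M * #|avoid S2|.
  by rewrite leq_mul2r sum4 orbT.
move=> c4; rewrite -(leq_pmul2l M_gt0); move: c4 bnd cov.
move: (\sum_(k in S1) #|_|) (\sum_(k in S1) c k) #|avoid S2| #|avoid S| => *.
lia.
Qed.

(** Chain rule: the events are excluded one at a time. Since [4 * c j <= M], each exclusion keeps at
    least half of the remaining points. *)
Lemma local_lemma : exists f : {ffun V -> T},
  (forall v, f v \in F v) /\ forall j, f \notin E j.
Proof.
suff : 0 < #|avoid setT|.
  rewrite card_gt0 => /set0Pn [f /avoidP [/avoid0P Ff nE]].
  by exists f; split=> // j; apply: nE; rewrite inE.
move: setT => S; elim: {S}_.+1 {-2}S (ltnSn #|S|) => // n IHn S leSn.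
have [->//|/set0Pn [j jSS]] := eqVneq S set0.
rewrite -(setD1K jSS); move: leSn; rewrite (cardsD1 j) jSS ltnS => /IHn.
have := setD11 j S; move: (S :\ j) => R /negbT jS IH.
have c4 : 4 * c j <= M.
  have [v vj] : exists v, v \in dep j.
    by apply/set0Pn; rewrite -card_gt0; case/andP: (dep_gt0 j).
  by move: (c_sum v); rewrite (bigD1 j) //=; nia.
have := local_lemma_cond jS.
have : #|avoid R| <= #|avoid (j |: R)| + #|E j :&: avoid R|.
  rewrite -(cardsID (E j) (avoid R)) addnC setIC leq_add2r.
  apply/subset_leq_card/subsetP => f; rewrite inE => /andP [nfj /avoidP [fF fS]].
  by apply/avoidP; split=> // k; rewrite !inE => /orP [/eqP -> //|]; apply: fS.
nia.
Qed.

End LocalLemma.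

(** * Dependent random choice *)

Lemma leq_chebyshev_pair (x y s : nat) :
  x * y ^ s + y * x ^ s <= x * x ^ s + y * y ^ s.
Proof.
wlog lexy : x y / x <= y.
  by move=> W; case: (leqP x y) => [|/ltnW] /W; lia.
have : x ^ s <= y ^ s by case: s => // s; rewrite leq_exp2r.
nia.
Qed.

Lemma leq_power_mean (I : finType) (A : {set I}) (x : I -> nat) (s : nat) :
  0 < s -> (\sum_(i in A) x i) ^ s <= #|A| ^ s.-1 * \sum_(i in A) x i ^ s.
Proof.
case: s => // s _ /=; elim: s => [|s IH].
  by rewrite expn1 expn0 mul1n; apply: leq_sum => i _; rewrite expn1.
set t := s.+1 in IH *.
rewrite [X in X <= _]expnS [#|A| ^ t]expnSr -mulnA.
apply: leq_trans (leq_mul (leqnn _) IH) _.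
rewrite mulnCA leq_mul2l; apply/orP; right.
(* Doubling makes both sides symmetric double sums over pairs, which compare termwise by
   [leq_chebyshev_pair]. *)
suff : 2 * ((\sum_(i in A) x i) * (\sum_(i in A) x i ^ t))
    <= 2 * (#|A| * \sum_(i in A) x i ^ t.+1) by rewrite leq_pmul2l.
have prodE (y z : I -> nat) : (\sum_(i in A) y i) * (\sum_(i in A) z i)
    = \sum_(i in A) \sum_(j in A) y i * z j.
  by rewrite big_distrl; apply: eq_bigr => i _; rewrite big_distrr.
have -> : 2 * ((\sum_(i in A) x i) * (\sum_(i in A) x i ^ t))
    = \sum_(i in A) \sum_(j in A) (x i * x j ^ t + x j * x i ^ t).
  rewrite mul2n -addnn {1}prodE mulnC prodE -big_split; apply: eq_bigr => i _.
  by rewrite -big_split; apply: eq_bigr => j _; rewrite /= [_ * x j]mulnC.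
have -> : 2 * (#|A| * \sum_(i in A) x i ^ t.+1)
    = \sum_(i in A) \sum_(j in A) (x i * x i ^ t + x j * x j ^ t).
  under [RHS]eq_bigr => i _ do rewrite big_split /= sum_nat_const.
  rewrite big_split /= -big_distrr sum_nat_const addnn -mul2n.
  by under eq_bigr => i _ do rewrite expnS.
by apply: leq_sum => i _; apply: leq_sum => j _; apply: leq_chebyshev_pair.
Qed.

(** Bernoulli's inequality for [(1 - 1/(k+1))^t]. It ensures that a density just below 1/2 costs
    only a factor 2 over all the samples. *)
Lemma bernoulli_pred (k t : nat) : 2 * t <= k.+1 -> k.+1 ^ t <= 2 * k ^ t.
Proof.
have tangent n : k.+1 ^ n <= k ^ n + n * k.+1 ^ n.-1.
  elim: n => [|n IH]; first by rewrite !expn0.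
  have le_kn : k ^ n <= k.+1 ^ n by case: (n) => // m; rewrite leq_exp2r.
  have -> : n.+1 * k.+1 ^ n.+1.-1 = k.+1 ^ n + k.+1 * (n * k.+1 ^ n.-1).
    by case: (n) => [|m] /=; rewrite ?expn0 ?expnS; lia.
  by rewrite !expnS; nia.
move=> tk; have := tangent t.
case: t tk => [|t] tk //=; rewrite expnS; move: (k.+1 ^ t) => q; nia.
Qed.

Section DependentRandomChoice.
Variables (T : finType) (r : rel T).

Definition common_out (B X : {set T}) : {set T} :=
  [set y in B | [forall x in X, r x y]].

(* The number of [s]-tuples of elements of [A] which, together with [X], have
   fewer than [#|B| / 2 ^ a] common out-neighbours in [B]. *)
Fixpoint bad_tuples (B : {set T}) (a : nat) (A : {set T}) (s : nat)
    (X : {set T}) : nat :=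
  if s is s'.+1 then \sum_(x in A) bad_tuples B a A s' (x |: X)
  else #|common_out B X| * 2 ^ a < #|B|.

Definition common_in (A : {set T}) (k : nat) (h : {ffun 'I_k -> T}) : {set T} :=
  [set x in A | [forall i, r x (h i)]].

Lemma common_out_sub B X : common_out B X \subset B.
Proof. by apply/subsetP => y; rewrite inE => /andP []. Qed.

Lemma common_outS B (X Y : {set T}) :
  X \subset Y -> common_out B Y \subset common_out B X.
Proof.
move=> /subsetP XY; apply/subsetP => y; rewrite !inE => /andP [-> /forall_inP ryY].
by apply/forall_inP => x /XY; apply: ryY.
Qed.

Lemma common_out0 B : common_out B set0 = B.
Proof.
apply/setP => y; rewrite inE; case: (y \in B) => //=.
by apply/forall_inP => x; rewrite inE.
Qed.

Lemma card_joined (A B X : {set T}) (k : nat) : X \subset A ->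
  \sum_(h : {ffun 'I_k -> T} | (h \in ffun_on (mem B)) && (X \subset common_in A h)) 1
  = #|common_out B X| ^ k.
Proof.
move=> XA; rewrite sum1_card -[k in RHS]card_ord -card_ffun_on.
apply: eq_card => h; rewrite !inE; apply/andP/ffun_onP.
  move=> [/ffun_onP hB /subsetP Xh] i; rewrite inE hB /=.
  by apply/forall_inP => x /Xh; rewrite inE => /andP [_ /forallP].
move=> hX; split; first by apply/ffun_onP => i; move: (hX i); rewrite inE => /andP [].
apply/subsetP => x xX; rewrite inE (subsetP XA) //=; apply/forallP => i.
by move: (hX i); rewrite inE => /andP [_ /forall_inP]; apply.
Qed.

Lemma sum_common_in (A B : {set T}) (k : nat) :
  \sum_(h : {ffun 'I_k -> T} | h \in ffun_on (mem B)) #|common_in A h|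
  = \sum_(x in A) #|common_out B [set x]| ^ k :> nat.
Proof.
rewrite (eq_bigr (fun h => \sum_(x in common_in A h) 1)); last first.
  by move=> h _; rewrite sum1_card.
rewrite (exchange_big_dep (mem A)) /=; last by move=> h x _; rewrite inE => /andP [].
apply: eq_bigr => x xA; rewrite -(@card_joined A) ?sub1set //.
by apply: eq_bigl => h; rewrite sub1set.
Qed.

(* A bad tuple survives in [common_in A h] only if all [k] samples fall in its
   common out-neighbourhood, of density less than [2 ^- a] in [B]. *)
Lemma sum_bad_tuples (A B : {set T}) (a k s : nat) (X : {set T}) : X \subset A ->
  (\sum_(h : {ffun 'I_k -> T} | (h \in ffun_on (mem B)) && (X \subset common_in A h))
    bad_tuples B a (common_in A h) s X) * 2 ^ (a * k) <= #|A| ^ s * #|B| ^ k.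
Proof.
elim: s X => [|s IH] X XA /=.
  rewrite expn0 mul1n; case: (boolP (_ < _)) => [bad|_]; last by rewrite big1.
  by rewrite card_joined // expnM -expnMn; case: (k) => // n; rewrite leq_exp2r // ltnW.
rewrite (exchange_big_dep (mem A)) /=; last by move=> h x _; rewrite inE => /andP [].
rewrite big_distrl /= expnS -mulnA -sum_nat_const; apply: leq_sum => x xA.
apply: leq_trans (IH (x |: X) _); last by rewrite subUset sub1set xA.
rewrite leq_mul2r; apply/orP; right.
rewrite (eq_bigl (fun h : {ffun 'I_k -> T} =>
  (h \in ffun_on (mem B)) && (x |: X \subset common_in A h))) // => h.
by rewrite subUset sub1set; case: (_ \in ffun_on _) => //=; rewrite andbC.
Qed.

(** Average over the [k]-tuples [h] of [B], with [m = #|A|]. The mean of [#|common_in A h|] is at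
    least [m / 2^(k+1)], so by convexity [2^((k+1)s+1)] times its [s]-th power has mean at least
    [2 m^s]. The bad tuples, weighted by [2^((k+1)s+1+e)], have mean at most [m^s]. An [h] whose
    difference is at least [m^s] gives both conclusions. *)
Lemma dependent_random_choice (A B : {set T}) (K a k s e : nat) :
  0 < s -> 2 * k <= K -> 0 < K -> 0 < #|A| -> 0 < #|B| ->
  K.-1 * #|A| * #|B| <= 2 * K * (\sum_(x in A) #|common_out B [set x]|) ->
  k.+1 * s + 1 + e <= a * k ->
  exists A' : {set T}, [/\ A' \subset A, #|A| <= 2 ^ (k + 2) * #|A'| &
    bad_tuples B a A' s set0 * 2 ^ e <= #|A'| ^ s].
Proof.
case: K => // K s0 kK _ A0 B0 dens ak.
set m := #|A| in A0 dens *; set n := #|B| in B0 dens *.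
have k0 : 0 < k by lia.
have mean : m * n ^ k <= 2 ^ k.+1 *
    \sum_(h : {ffun 'I_k -> T} | h \in ffun_on (mem B)) #|common_in A h|.
  rewrite sum_common_in.
  have := leq_power_mean A (fun x => #|common_out B [set x]|) k0.
  set D := \sum_(x in A) _ in dens *; set Dk := \sum_(x in A) _; rewrite -/m => pm.
  have mK : m ^ k.-1 * m = m ^ k by rewrite -expnSr prednK.
  have d2 : (K * m * n) ^ k <= (2 * K.+1 * D) ^ k by rewrite leq_exp2r.
  have b2 := bernoulli_pred kK.
  have Kp : 0 < K.+1 ^ k by rewrite expn_gt0.
  have mp : 0 < m ^ k.-1 by rewrite expn_gt0 A0.
  move: d2; rewrite !expnMn => d2.
  rewrite -(leq_pmul2l mp) -(leq_pmul2l Kp) [2 ^ k.+1]expnS.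
  move: d2 pm b2; rewrite -mK.
  move: (m ^ k.-1) (n ^ k) (2 ^ k) (K ^ k) (K.+1 ^ k) (D ^ k) => x y z u v w d2 pm b2.
  have : u * (x * m) * y <= z * v * (x * Dk).
    by apply: leq_trans d2 _; rewrite leq_mul2l pm orbT.
  have : v * (x * m * y) <= 2 * u * (x * m * y) by rewrite leq_mul2r b2 orbT.
  lia.
pose Om := ffun_on (mem B) : pred {ffun 'I_k -> T}.
have cardOm : #|[set h | h \in Om]| = n ^ k.
  by rewrite cardsE card_ffun_on card_ord.
have sumOm : \sum_(h in Om) 1 = n ^ k by rewrite -cardOm sum1_card cardsE.
have sumE f : \sum_(h in [set h | h \in Om]) f h = \sum_(h in Om) f h :> nat.
  by apply: eq_bigl => h; rewrite inE.
have [h hO le] : exists2 h : {ffun 'I_k -> T}, h \in Om &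
    2 ^ (k.+1 * s + 1 + e) * bad_tuples B a (common_in A h) s set0 + m ^ s
    <= 2 ^ (k.+1 * s + 1) * #|common_in A h| ^ s.
  apply/exists_inP; apply: contraT; rewrite negb_exists_in => /forall_inP none.
  have lt h : h \in Om -> 2 ^ (k.+1 * s + 1) * #|common_in A h| ^ s <
      2 ^ (k.+1 * s + 1 + e) * bad_tuples B a (common_in A h) s set0 + m ^ s.
    by move=> /none; rewrite -ltnNge.
  have ltS : (\sum_(h in Om) 2 ^ (k.+1 * s + 1) * #|common_in A h| ^ s) + n ^ k <=
      \sum_(h in Om)
        (2 ^ (k.+1 * s + 1 + e) * bad_tuples B a (common_in A h) s set0 + m ^ s).
    rewrite -sumOm -big_split; apply: leq_sum => h /lt.
    by rewrite /= [X in _ -> X <= _]addn1.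
  have bad : 2 ^ (k.+1 * s + 1 + e) * (\sum_(h in Om) bad_tuples B a (common_in A h) s set0)
      <= m ^ s * n ^ k.
    have := @sum_bad_tuples A B a k s set0 (sub0set A).
    rewrite (eq_bigl (fun h => h \in Om)); last by move=> h; rewrite sub0set andbT.
    apply: leq_trans; rewrite mulnC leq_mul2l; apply/orP; right.
    by rewrite leq_pexp2l.
  have good : 2 * (m ^ s * n ^ k)
      <= 2 ^ (k.+1 * s + 1) * (\sum_(h in Om) #|common_in A h| ^ s).
    have := leq_power_mean [set h | h \in Om] (fun h => #|common_in A h|) s0.
    rewrite cardOm !sumE => pm.
    have np : 0 < (n ^ k) ^ s.-1 by rewrite !expn_gt0 B0.
    have nK : (n ^ k) ^ s.-1 * n ^ k = (n ^ k) ^ s by rewrite -expnSr prednK.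
    have : (m * n ^ k) ^ s <= (2 ^ k.+1 * \sum_(h in Om) #|common_in A h|) ^ s.
      by rewrite leq_exp2r.
    rewrite !expnMn -(expnM 2) -nK => mn.
    rewrite -(leq_pmul2l np) addn1 expnS; nia.
  move: ltS; rewrite big_split /= -!big_distrr /= sum_nat_const.
  rewrite (_ : #|Om| = n ^ k); last by rewrite -cardOm cardsE.
  have : 0 < n ^ k by rewrite expn_gt0 B0.
  by move: bad good; rewrite /=; nia.
exists (common_in A h); split.
- by apply/subsetP => x; rewrite inE => /andP [].
- have : m ^ s <= (2 ^ (k + 2) * #|common_in A h|) ^ s.
    rewrite expnMn -expnM.
    apply: (@leq_trans (2 ^ (k.+1 * s + 1) * #|common_in A h| ^ s)); first by lia.
    by rewrite leq_mul2r leq_pexp2l ?orbT //; nia.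
  by rewrite leq_exp2r.
- have : 2 ^ (k.+1 * s + 1 + e) * bad_tuples B a (common_in A h) s set0
      <= 2 ^ (k.+1 * s + 1) * #|common_in A h| ^ s by lia.
  by rewrite expnD -mulnA leq_pmul2l ?expn_gt0 // mulnC.
Qed.

End DependentRandomChoice.

(** * Backward construction of the reservoirs *)

Lemma dense_chunk (T : Type) (d : T -> nat) (p q m k : nat) (blk : seq T) :
  0 < k -> size blk = k * m -> p * size blk <= q * \sum_(x <- blk) d x ->
  exists c1 c c2, [/\ blk = c1 ++ c ++ c2, size c = m &
    p * m <= q * \sum_(x <- c) d x].
Proof.
elim: k blk => // k IH blk _ szb dens.
have szt : size (take m blk) = m by rewrite size_takel ?szb; lia.
have szd : size (drop m blk) = k * m by rewrite size_drop szb; lia.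
have [ok|nok] := leqP (p * m) (q * \sum_(x <- take m blk) d x).
  by exists [::], (take m blk), (drop m blk); split=> //=; rewrite cat_take_drop.
move: dens; rewrite -{2}(cat_take_drop m blk) big_cat /= szb => dens.
case: k => [|k] in IH szd szb dens *.
  by move/size0nil: szd dens => ->; rewrite big_nil; lia.
have [|c1 [c [c2 [dE szc dc]]]] := IH _ (ltn0Sn k) szd; first by rewrite szd; lia.
exists (take m blk ++ c1), c, c2; split=> //.
by rewrite -catA -dE cat_take_drop.
Qed.

Section Chain.
Variables (T : finType) (r : rel T) (o : seq T).
Hypothesis o_uniq : uniq o.
Hypothesis o_median : forall pre mid y post, o = pre ++ mid ++ y :: post ->
  size mid <= 2 * count (r^~ y) mid.

(** For [y] in [B], apply the median property to [blk] followed by the part [c1] of [cur] before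
    [y]. At least half of this interval sends edges to [y], and discarding [c1] loses little,
    because [cur] is at most [1/K] as long as [blk]. *)
Lemma block_density (B : {set T}) (K : nat) (pre blk cur rest : seq T) :
  o = pre ++ blk ++ cur ++ rest -> {subset B <= cur} -> 0 < K ->
  K * size cur <= size blk ->
  K.-1 * #|B| * size blk <= 2 * K * \sum_(x <- blk) #|common_out r B [set x]|.
Proof.
move=> oE Bcur K0 Kle.
have -> : \sum_(x <- blk) #|common_out r B [set x]| = \sum_(y in B) count (r^~ y) blk.
  rewrite (eq_bigr (fun x => \sum_(y in B) r x y)); last first.
    move=> x _; rewrite -sum1_card big_mkcond [RHS]big_mkcond; apply: eq_bigr => y _.
    rewrite inE; case: (y \in B) => //=.
    have -> : [forall z in [set x], r z y] = r x y.
      apply/forall_inP/idP => [|rxy z]; first by apply; rewrite inE.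
      by rewrite inE => /eqP ->.
    by case: (r x y).
  rewrite exchange_big; apply: eq_bigr => y _ /=.
  by elim: (blk) => [|x s IH]; rewrite ?big_nil // big_cons IH.
rewrite mulnAC [K.-1 * _ * _]mulnC -sum_nat_const big_distrr /=.
apply: leq_sum => y /Bcur /splitPr cE; move: cE oE Kle => [c1 c2] oE Kle.
have := @o_median pre (blk ++ c1) y (c2 ++ rest).
rewrite oE -!catA => /(_ erefl).
rewrite size_cat count_cat size_cat /= in Kle *.
have := count_size (r^~ y) c1; nia.
Qed.

Variables (K H : nat) (m k s a e : nat -> nat).
Hypothesis K_gt0 : 0 < K.
Hypothesis s_gt0 : forall i, 0 < s i.
Hypothesis k_le : forall i, 1 <= i <= H -> 2 * k i <= K.
Hypothesis a_ge : forall i, 1 <= i <= H ->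
  (k i).+1 * s i + 1 + e i <= a i * k i.
Hypothesis o_size : K.+1 * (1 + \sum_(1 <= i < H.+1) m i) <= size o.

Lemma chain : exists B : nat -> {set T}, forall i, 1 <= i <= H -> 0 < m i ->
  [/\ m i <= 2 ^ (k i + 2) * #|B i|,
      forall j, 1 <= j <= H -> 0 < m j -> i <> j -> [disjoint B i & B j]
    & i < H -> 0 < m i.+1 ->
      bad_tuples r (B i.+1) (a i) (B i) (s i) set0 * 2 ^ e i <= #|B i| ^ s i].
Proof.
(* After [n] layers, [C] is the set most recently extracted, or the initial singleton, and [cur] is
   an interval containing it. The prefix [pre] is untouched and keeps [K * size cur] elements for
   the next block, and [K.+1 * m j] for each remaining layer. *)
suff state n : n <= H -> exists B : nat -> {set T},
  exists (C : {set T}) (pre cur rest : seq T),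
  [/\ [/\ o = pre ++ cur ++ rest, {subset C <= cur}, 0 < #|C| &
          K * size cur + K.+1 * (\sum_(1 <= i < (H - n).+1) m i) <= size pre],
      0 < n -> 0 < m (H - n).+1 -> C = B (H - n).+1
    & forall i, H - n < i <= H -> 0 < m i ->
      [/\ m i <= 2 ^ (k i + 2) * #|B i|, {subset B i <= cur ++ rest},
          forall j, H - n < j <= H -> 0 < m j -> i <> j -> [disjoint B i & B j]
        & i < H -> 0 < m i.+1 ->
          bad_tuples r (B i.+1) (a i) (B i) (s i) set0 * 2 ^ e i <= #|B i| ^ s i]].
  have [B [C [pre [cur [rest [_ _ BP]]]]]] := state H (leqnn H).
  rewrite subnn in BP; exists B => i iH mi.
  by have [? _ ? ?] := BP i iH mi.
elim: n => [|n IH] leH.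
  have [o' [y oE]] : exists o' y, o = rcons o' y.
    have : 0 < size o by lia.
    by case/lastP: (o) => // o' y _; exists o', y.
  exists (fun=> set0), [set y], o', [:: y], [::]; split=> //; last by move=> i; lia.
  split; rewrite ?cats0 ?cats1 ?cards1 //; first by move=> x; rewrite !inE.
  by move: o_size; rewrite oE subn0 size_rcons /=; lia.
have [B [C [pre [cur [rest [[oE Ccur C0 szpre] CB BP]]]]]] := IH (ltnW leH).
set i := H - n in szpre CB BP.
have iE : H - n.+1 = i.-1 by rewrite /i; lia.
have i0 : 0 < i by rewrite /i; lia.
have iH : 1 <= i <= H by rewrite /i; lia.
rewrite iE prednK //.
have sumE : \sum_(1 <= j < i.+1) m j = \sum_(1 <= j < i) m j + m i.
  by rewrite big_nat_recr.
case: (posnP (m i)) => [mi0|mi].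
  exists B, C, pre, cur, rest; split=> //.
  - by split=> //; rewrite sumE mi0 addn0 in szpre.
  move=> j jH mj; have ji : j <> i by move=> ji; rewrite ji mi0 in mj.
  have jH' : i < j <= H by lia.
  have [? ? dis ?] := BP j jH' mj; split=> // l lH ml; apply: dis => //.
  have li : l <> i by move=> li; rewrite li mi0 in ml.
  by lia.
(* Rounding up, [q] chunks of length [m i] form a block at least [K] times as long as [cur]. The
   excess is less than [m i], so the budget [K.+1 * m i] still leaves [K * m i] for the next
   block. *)
pose q := (K * size cur + m i - 1) %/ m i.
have cur0 : 0 < size cur.
  by case/card_gt0P: C0 => x /Ccur; case: (cur).
have [qlo qhi] : K * size cur <= q * m i /\ q * m i < K * size cur + m i.
  rewrite /q.
  have := divn_eq (K * size cur + m i - 1) (m i).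
  by have := ltn_pmod (K * size cur + m i - 1) mi; lia.
have q0 : 0 < q by case: (q) qlo => //; nia.
have lepre : q * m i <= size pre by rewrite sumE in szpre; nia.
pose blk := drop (size pre - q * m i) pre.
pose pre0 := take (size pre - q * m i) pre.
have preE : pre = pre0 ++ blk by rewrite cat_take_drop.
have szblk : size blk = q * m i by rewrite size_drop; lia.
have szpre0 : size pre0 = size pre - q * m i by rewrite size_takel //; lia.
have dens : K.-1 * #|C| * size blk <= 2 * K * \sum_(x <- blk) #|common_out r C [set x]|.
  apply: (@block_density C K pre0 blk cur rest) => //; last by rewrite szblk.
  by rewrite oE preE -catA.
have [c1 [c [c2 [blkE szc densc]]]] := dense_chunk q0 szblk dens.
have oE' : o = (pre0 ++ c1) ++ c ++ (c2 ++ cur ++ rest) by rewrite oE preE blkE -!catA.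
have uc : uniq c.
  by move: o_uniq; rewrite oE' cat_uniq => /and3P [_ _]; rewrite cat_uniq => /and3P [].
pose A := [set x in c].
have cardA : #|A| = m i by rewrite cardsE -szc; apply/card_uniqP.
have dA : K.-1 * #|A| * #|C| <= 2 * K * (\sum_(x in A) #|common_out r C [set x]|).
  rewrite cardA mulnAC; apply: leq_trans densc _.
  rewrite big_uniq //= leq_mul2l; apply/orP; right; apply: eq_leq.
  by apply: eq_bigl => x; rewrite inE.
have A0 : 0 < #|A| by rewrite cardA.
have [D [DA szD badD]] :=
  dependent_random_choice (s_gt0 i) (k_le iH) K_gt0 A0 C0 dA (a_ge iH).
have Dc : {subset D <= c} by move=> x /(subsetP DA); rewrite inE.
have disc (x : T) : x \in D -> x \in cur ++ rest -> false.
  move=> /Dc xc xr; move: o_uniq; rewrite oE' cat_uniq => /and3P [_ _].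
  rewrite cat_uniq => /and3P [_ /hasPn /(_ x)]; rewrite mem_cat xr orbT xc.
  by move=> /(_ isT).
pose B' j := if j == i then D else B j.
have B'i : B' i = D by rewrite /B' eqxx.
have B'j j : i < j -> B' j = B j by rewrite /B'; case: eqP => // ->; rewrite ltnn.
exists B', D, (pre0 ++ c1), c, (c2 ++ cur ++ rest); split.
- split=> //.
    by rewrite card_gt0; apply: contraTneq szD => ->; rewrite cards0; lia.
  by rewrite szc size_cat szpre0; rewrite sumE in szpre; lia.
- by rewrite B'i.
move=> j jH mj.
have [ji|ji] : j = i \/ i < j by lia.
  rewrite ji B'i; split.
  - by rewrite -cardA.
  - by move=> x /Dc; rewrite mem_cat => ->.
  - move=> l lH ml il; have il' : i < l by lia.
    rewrite B'j //; have lH' : i < l <= H by lia.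
    have [_ Bl _ _] := BP l lH' ml.
    by rewrite disjoint_subset; apply/subsetP => x /disc xD; apply/negP => /Bl /xD.
  - move=> ltiH mi1; rewrite B'j // -CB //.
    by move: ltiH; rewrite /i; lia.
have jH' : i < j <= H by lia.
have [szj Bj disj badj] := BP j jH' mj.
rewrite B'j //; split=> //.
- by move=> x /Bj; rewrite !mem_cat => /orP [] ->; rewrite !orbT.
- move=> l lH ml jl; have [li|li] : l = i \/ i < l by lia.
    rewrite li B'i disjoint_sym disjoint_subset.
    by apply/subsetP => x /disc xD; apply/negP => /Bj /xD.
  by rewrite B'j //; apply: disj => //; lia.
- by move=> jltH mj1; rewrite B'j; [apply: badj | lia].
Qed.

End Chain.

(** * Bad tuples inside lists *)

(** With no events, [avoid] is the product space itself, so [avoid0P] serves as its membership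
    test. *)
Lemma card_family_prod (V T : finType) (F : V -> {set T}) :
  #|avoid F (fun _ : void => set0) set0| = \prod_v #|F v|.
Proof.
rewrite (_ : #|avoid _ _ _| = #|family (fun v => mem (F v))|); last first.
  apply: eq_card => f; apply/avoid0P/familyP => Ff v; exact: Ff.
by rewrite card_family foldrE big_map big_enum.
Qed.

Section BadCount.
Variables (V T : finType) (r : rel T) (B' B : {set T}) (a : nat).

Lemma bad_tuplesS (s : nat) (X Y : {set T}) : X \subset Y ->
  bad_tuples r B' a B s X <= bad_tuples r B' a B s Y.
Proof.
elim: s X Y => [|s IH] X Y XY /=; last first.
  by apply: leq_sum => x _; apply/IH/setUS.
have := subset_leq_card (common_outS r B' XY); rewrite -(leq_pmul2r (expn_gt0 2 a)).
by move=> le; case: (ltnP _ #|B'|) => // lt; rewrite (leq_ltn_trans le lt).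
Qed.

(** An in-neighbourhood may have fewer than the maximal number of vertices. Padding a bad tuple
    keeps it bad, since common out-neighbourhoods only shrink. *)
Lemma bad_tuples_extend (s n : nat) (X : {set T}) :
  bad_tuples r B' a B s X * #|B| ^ n <= bad_tuples r B' a B (s + n) X.
Proof.
elim: n => [|n IH]; first by rewrite muln1 addn0.
rewrite expnSr mulnA addnS; apply: leq_trans (leq_mul IH (leqnn _)) _.
rewrite mulnC -sum_nat_const /=; apply: leq_sum => x _.
exact/bad_tuplesS/subsetUr.
Qed.

Definition bad_fun (F : V -> {set T}) (D : {set V}) (X : {set T}) :
    {set {ffun V -> T}} :=
  [set f : {ffun V -> T} | [forall v, f v \in F v] &&
     (#|common_out r B' (X :|: f @: D)| * 2 ^ a < #|B'|)].

(** Induction on [D]: fixing the value [x] of one vertex [u] makes its list a singleton and moves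
    [x] into [X], which mirrors the recursion of [bad_tuples]. *)
Lemma card_bad_fun (F : V -> {set T}) (D : {set V}) (X : {set T}) :
  (forall v, v \in D -> F v \subset B) ->
  #|bad_fun F D X| <= bad_tuples r B' a B #|D| X * \prod_(v | v \notin D) #|F v|.
Proof.
move: {2}#|D| (erefl #|D|) => n; elim: n D F X => [|n IH] D F X cD FB.
  move/eqP: cD; rewrite cards_eq0 => /eqP D0; rewrite D0 cards0 /=.
  case: ltnP => bad; last first.
    rewrite leqn0 cards_eq0; apply/eqP/setP => f.
    by rewrite !inE imset0 setU0 ltnNge bad andbF.
  rewrite mul1n (eq_bigl predT); last by move=> v; rewrite inE.
  rewrite -card_family_prod; apply/subset_leq_card/subsetP => f.
  by rewrite inE => /andP [/forallP Ff _]; apply/avoid0P.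
have [u uD] : exists u, u \in D by apply/set0Pn; rewrite -cards_eq0 cD.
have cD' : #|D :\ u| = n by move: cD; rewrite (cardsD1 u) uD; case.
pose Fx x v := if v == u then [set x] else F v.
have sub : bad_fun F D X \subset \bigcup_(x in F u) bad_fun (Fx x) (D :\ u) (x |: X).
  apply/subsetP => f; rewrite inE => /andP [/forallP Ff bad].
  apply/bigcupP; exists (f u) => //; rewrite inE; apply/andP; split.
    by apply/forallP => v; rewrite /Fx; case: eqP => [->|_]; rewrite ?inE.
  by move: bad; rewrite -{1}(setD1K uD) imsetU1 setUCA setUA.
apply: leq_trans (subset_leq_card sub) _.
apply: (@leq_trans (\sum_(x in F u) #|bad_fun (Fx x) (D :\ u) (x |: X)|)).
  elim/big_ind2: _ => [|m1 A1 m2 A2 le1 le2|x _]; rewrite ?cards0 //.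
  exact: leq_trans (leq_card_setU _ _) (leq_add le1 le2).
rewrite cD /= big_distrl /= big_mkcond [X in _ <= X]big_mkcond.
apply: leq_sum => x _; case: ifP => // xF.
rewrite (subsetP (FB u uD) x xF).
apply: leq_trans (IH _ _ _ cD' _) _.
  by move=> v /setD1P [vu vD]; rewrite /Fx (negbTE vu); apply: FB.
rewrite cD' leq_mul2l; apply/orP; right.
rewrite (bigD1 u) /=; last by rewrite setD11.
rewrite /Fx eqxx cards1 mul1n; apply: eq_leq.
have eqD v : (v \notin D :\ u) && (v != u) = (v \notin D).
  by rewrite !inE; case: eqP => [->|_]; rewrite ?uD ?andbT.
rewrite (eq_bigl _ _ eqD).
by apply: eq_bigr => v vD; case: eqP => // vu; rewrite vu uD in vD.
Qed.

(** Restricting at most [s] coordinates to lists of density [2^-p] in [B] multiplies the probability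
    of badness by at most [2^(s * p)], which leaves [2^-q]. *)
Lemma bad_fun_prob (F : V -> {set T}) (D : {set V}) (s p q : nat) :
  #|D| <= s -> 0 < #|B| -> (forall v, v \in D -> F v \subset B) ->
  (forall v, v \in D -> #|B| <= 2 ^ p * #|F v|) ->
  bad_tuples r B' a B s set0 * 2 ^ (s * p + q) <= #|B| ^ s ->
  2 ^ q * #|bad_fun F D set0| <= \prod_v #|F v|.
Proof.
move=> Ds B0 FB Fp bad.
apply: leq_trans (leq_mul (leqnn _) (card_bad_fun _ FB)) _.
rewrite [X in _ <= X](bigID (mem D)) /= mulnA leq_mul2r; apply/orP; right.
have prodD : #|B| ^ #|D| <= 2 ^ (p * #|D|) * \prod_(v in D) #|F v|.
  rewrite expnM -!prod_nat_const -big_split /=.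
  by apply: leq_prod => v vD; apply: Fp.
have := bad_tuples_extend #|D| (s - #|D|) set0; rewrite subnKC // => ext.
have Bn : 0 < #|B| ^ (s - #|D|) by rewrite expn_gt0 B0.
have pp : 0 < 2 ^ (s * p) by rewrite expn_gt0.
rewrite -(leq_pmul2l Bn) -(leq_pmul2l pp).
apply: (@leq_trans (bad_tuples r B' a B s set0 * 2 ^ (s * p + q))).
  rewrite expnD; apply: leq_trans (leq_mul ext (leqnn _)).
  by apply: eq_leq; lia.
apply: leq_trans bad _; rewrite -{1}(subnK Ds) expnD.
rewrite mulnCA leq_mul2l; apply/orP; right; apply: leq_trans prodD _.
by rewrite leq_mul2r leq_pexp2l ?orbT // mulnC leq_mul2r Ds orbT.
Qed.

End BadCount.

(** Overwriting the value at [u'] by any element of [F u'] is injective on functions with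
    [f u = f u'], because the lost value can still be read at [u]. *)
Lemma card_collision (V T : finType) (F : V -> {set T}) (u u' : V) : u != u' ->
  #|[set f : {ffun V -> T} | [forall v, f v \in F v] && (f u == f u')]| * #|F u'|
  <= \prod_v #|F v|.
Proof.
move=> uu'; rewrite -card_family_prod -cardsX.
pose upd (q : {ffun V -> T} * T) := [ffun v => if v == u' then q.2 else q.1 v].
rewrite -(@card_in_imset _ _ upd).
  apply/subset_leq_card/subsetP => _ /imsetP [[f x] fxP ->].
  apply/avoid0P => v; move: fxP; rewrite !inE ffunE /=.
  by move=> /andP [/andP [/forallP Ff _] xF]; case: eqP => [->|_].
move=> [f x] [g y]; rewrite !inE /= => /andP [/andP [_ /eqP fu] _].
move=> /andP [/andP [_ /eqP gu] _] /ffunP E.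
have xy : x = y by move: (E u'); rewrite !ffunE eqxx.
congr pair => //; apply/ffunP => v.
have off w : w != u' -> f w = g w.
  by move=> wu; move: (E w); rewrite !ffunE /= (negbTE wu).
have [->|/off //] := eqVneq v u'.
by rewrite -fu -gu; apply: off.
Qed.

(** * Embedding one layer *)

Section LayerEmbedding.
Variables (V T : finType) (e : rel V) (r : rel T).
Variables (U W : {set V}) (B B' : {set T}) (L : V -> {set T}) (b : pred V).
Variables (p a s d S D x y : nat).

Hypothesis B_gt0 : 0 < #|B|.
Hypothesis L_sub : forall u, u \in U -> L u \subset B.
Hypothesis L_dense : forall u, u \in U -> #|B| <= 2 ^ p * #|L u|.
Hypothesis s_bound : 0 < s <= S.
Hypothesis in_sub : forall w, w \in W -> [set u | e u w] \subset U.
Hypothesis in_le : forall w, w \in W -> in_degree e w <= s.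
Hypothesis out_le : forall u, out_degree e u <= D.
Hypothesis D_le : 8 * D <= 2 ^ d.
Hypotheses (x_gt0 : 0 < x) (y_gt0 : 0 < y).
Hypothesis x_ge : 64 * S * #|[set u in U | b u]| <= x.
Hypothesis y_ge : 64 * S * #|[set u in U | ~~ b u]| <= y.
Hypothesis L_ge : forall u, u \in U -> (if b u then x else y) <= #|L u|.
Hypothesis few_bad : forall w, w \in W ->
  bad_tuples r B' a B s set0 * 2 ^ (s * p + (s + d)) <= #|B| ^ s.

(** The default [B] outside [U] keeps the product space nonempty. *)
Let F v := if v \in U then L v else B.
Let size_of v := if b v then x else y.
(** This is [x * y / size_of v], so that reciprocals of list sizes become integers over the common
    denominator [x * y]. *)
Let cosize v := if b v then y else x.
Let active_w w := (w \in W) && (0 < in_degree e w).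
(** Each collision is charged to the endpoint with the larger [size_of], which gives the smaller
    probability bound. *)
Let active_uu (q : V * V) :=
  [&& q.1 \in U, q.2 \in U, q.1 != q.2 & size_of q.1 <= size_of q.2].

Let event (j : V + V * V) : {set {ffun V -> T}} :=
  match j with
  | inl w => if active_w w then
      [set f : {ffun V -> T} |
        #|common_out r B' (f @: [set u | e u w])| * 2 ^ a < #|B'|] else set0
  | inr q => if active_uu q then [set f : {ffun V -> T} | f q.1 == f q.2] else set0
  end.

(** The value [[set w]] for an inactive [w] is a default: the local lemma requires [dep j] to be
    nonempty. *)
Let dep (j : V + V * V) : {set V} :=
  match j with
  | inl w => if active_w w then [set u | e u w] else [set w]
  | inr q => [set q.1; q.2]
  end.

Let M := 2 ^ (s + d) * (x * y).

(* [cost j / M] bounds the probability of [event j]. *)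
Let cost (j : V + V * V) : nat :=
  match j with
  | inl w => if active_w w then x * y else 0
  | inr q => if active_uu q then 2 ^ (s + d) * cosize q.2 else 0
  end.

Lemma event_dep j : determined (dep j) (event j).
Proof.
case: j => [w|[u u']] f g /=.
  case: ifP => [_ fg|]; last by rewrite !inE.
  have fgE : f @: [set u | e u w] = g @: [set u | e u w] by apply: eq_in_imset.
  by rewrite [f \in _]inE [g \in _]inE fgE.
case: ifP => [_ fg|]; last by rewrite !inE.
by rewrite [f \in _]inE [g \in _]inE !fg // !inE eqxx ?orbT.
Qed.

Lemma event_prob j :
  M * #|event j :&: avoid F event set0| <= cost j * #|avoid F event set0|.
Proof.
have cardF : #|avoid F event set0| = \prod_v #|F v|.
  rewrite -card_family_prod; apply: eq_card => f.
  by apply/avoid0P/avoid0P.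
have FL v : v \in U -> F v = L v by rewrite /F => ->.
rewrite cardF; case: j => [w|[u u']] /=; case: ifP => act;
  rewrite ?set0I ?cards0 ?muln0 //.
  case/andP: act => wW win.
  rewrite /M mulnC mulnA [_ * (x * y)]mulnC leq_mul2l; apply/orP; right.
  rewrite mulnC.
  have FB v : v \in [set u | e u w] -> F v \subset B.
    by move=> /(subsetP (in_sub wW)) vU; rewrite FL // L_sub.
  have Fp v : v \in [set u | e u w] -> #|B| <= 2 ^ p * #|F v|.
    by move=> /(subsetP (in_sub wW)) vU; rewrite FL // L_dense.
  have := bad_fun_prob (in_le wW : #|[set u | e u w]| <= s) B_gt0 FB Fp (few_bad wW).
  apply: leq_trans.
  rewrite leq_mul2l; apply/orP; right.
  apply/subset_leq_card/subsetP => f /setIP [fb /avoid0P Ff].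
  by move: fb; rewrite !inE set0U => ->; rewrite andbT; apply/forallP.
case/and4P: act => /= uU u'U uu' _.
have le : #|[set f : {ffun V -> T} | f u == f u'] :&: avoid F event set0| * size_of u'
    <= \prod_v #|F v|.
  apply: leq_trans (card_collision F uu'); apply: leq_mul; last by rewrite FL ?L_ge.
  apply/subset_leq_card/subsetP => f /setIP [fb /avoid0P Ff].
  by move: fb; rewrite !inE => ->; rewrite andbT; apply/forallP.
have -> : M = 2 ^ (s + d) * cosize u' * size_of u'.
  by rewrite /M /cosize /size_of -mulnA; case: (b u') => //; rewrite [y * x]mulnC.
by rewrite -mulnA leq_mul2l [size_of _ * _]mulnC le orbT.
Qed.

Lemma sum_cosize : 32 * S * (\sum_(u in U) cosize u) <= x * y.
Proof.
rewrite (bigID b) /=.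
have -> : \sum_(u in U | b u) cosize u = #|[set u in U | b u]| * y.
  rewrite -sum_nat_const; apply: eq_big => [u|u /andP [_ bu]]; first by rewrite inE.
  by rewrite /cosize bu.
have -> : \sum_(u in U | ~~ b u) cosize u = #|[set u in U | ~~ b u]| * x.
  rewrite -sum_nat_const; apply: eq_big => [u|u /andP [_ bu]]; first by rewrite inE.
  by rewrite /cosize (negbTE bu).
have := leq_mul x_ge (leqnn y); have := leq_mul y_ge (leqnn x); lia.
Qed.

(** At most [D] tuple events involve [v], each of probability at most [2^-(s+d)]. The collisions at
    [v] total at most twice the sum of the reciprocals of [size_of] over [U], that is [1/(16 S)].
    Either kind uses at most half of the budget. *)
Lemma cost_sum v : 4 * s.+1 * (\sum_(j | v \in dep j) cost j) <= M.
Proof.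
rewrite big_sumType /=.
have costW : \sum_(w | v \in dep (inl w)) cost (inl w) <= D * (x * y).
  apply: (@leq_trans (\sum_(w in [set w | e v w]) x * y)); last first.
    by rewrite sum_nat_const leq_mul2r out_le orbT.
  rewrite big_mkcond [X in _ <= X]big_mkcond; apply: leq_sum => w _ /=.
  by rewrite inE; case: (active_w w); rewrite ?inE //; case: ifP.
have costU : \sum_(q | v \in dep (inr q)) cost (inr q)
    <= 2 * (2 ^ (s + d) * \sum_(u in U) cosize u).
  rewrite big_mkcond /= -(pair_big predT predT (fun u u' =>
    if v \in [set u; u'] then cost (inr (u, u')) else 0)) /=.
  apply: (@leq_trans (\sum_u \sum_u' ((u == v) * cost (inr (u, u'))
      + (u' == v) * cost (inr (u, u'))))).
    apply: leq_sum => u _; apply: leq_sum => u' _; rewrite !inE ![v == _]eq_sym.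
    by case: eqP => _ /=; [rewrite mul1n leq_addr | case: eqP; rewrite ?mul1n ?mul0n].
  under eq_bigr => u _ do rewrite big_split.
  rewrite big_split /= mul2n -addnn; apply: leq_add.
    rewrite (bigD1 v) //= [X in _ + X]big1 ?addn0; last first.
      by move=> u /negbTE uv; apply: big1 => u' _; rewrite uv.
    rewrite big_distrr [X in _ <= X]big_mkcond; apply: leq_sum => u' _.
    rewrite eqxx mul1n /active_uu /=; case: (u' \in U); last by rewrite andbF.
    by case: ifP.
  rewrite exchange_big /= (bigD1 v) //= [X in _ + X]big1 ?addn0; last first.
    by move=> u /negbTE uv; apply: big1 => u' _; rewrite uv.
  rewrite big_distrr [X in _ <= X]big_mkcond; apply: leq_sum => u _.
  rewrite eqxx mul1n; case: ifP => // /and4P [/= -> _ _ le].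
  rewrite leq_mul2l; apply/orP; right; move: le; rewrite /size_of /cosize.
  by case: (b u); case: (b v).
apply: leq_trans (leq_mul (leqnn _) (leq_add costW costU)) _.
rewrite /M; have s2 : s.+1 <= 2 ^ s by rewrite ltn_expl.
have := sum_cosize; set Z := \sum_(u in U) _ => ZU.
have h1 : 8 * (s.+1 * D) <= 2 ^ (s + d) by rewrite expnD; have := leq_mul s2 D_le; lia.
have h1' : 8 * (s.+1 * D) * (x * y) <= 2 ^ (s + d) * (x * y).
  by rewrite leq_mul2r h1 orbT.
have h2 : 16 * s.+1 * Z <= x * y.
  by apply: leq_trans ZU; rewrite leq_mul2r; apply/orP; right; lia.
have h2' : 2 ^ (s + d) * (16 * s.+1 * Z) <= 2 ^ (s + d) * (x * y).
  by rewrite leq_mul2l h2 orbT.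
lia.
Qed.

Lemma layer_embedding : exists f : {ffun V -> T},
  [/\ forall u, u \in U -> f u \in L u, {in U &, injective f}
    & forall w, w \in W -> 0 < in_degree e w ->
        #|B'| <= #|common_out r B' (f @: [set u | e u w])| * 2 ^ a].
Proof.
have F0 : 0 < #|avoid F event set0|.
  have [t tB] : exists t, t \in B by apply/set0Pn; rewrite -card_gt0.
  have pick v : exists t, t \in F v.
    rewrite /F; case: ifP => vU; last by exists t.
    apply/set0Pn; rewrite -card_gt0; apply: leq_trans (L_ge vU).
    by case: ifP.
  rewrite card_gt0; apply/set0Pn.
  exists [ffun v => xchoose (pick v)]; apply/avoid0P => v.
  by rewrite ffunE; exact: (xchooseP (pick v)).
(* The bound is [s.+1] rather than [s] because a collision involves two vertices even when
   [s = 1]. *)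
have dep0 j : 0 < #|dep j| <= s.+1.
  case: j => [w|[u u']] /=.
    case: ifP => [/andP [wW win]|_]; last by rewrite cards1.
    by rewrite win; have := in_le wW; rewrite /in_degree; lia.
  by rewrite cards2; case: (u != u'); lia.
have M0 : 0 < M by rewrite !muln_gt0 expn_gt0 x_gt0.
have [f [Ff nE]] := local_lemma event_dep M0 (ltn0Sn s) F0 dep0 event_prob cost_sum.
exists f; split.
- by move=> u uU; move: (Ff u); rewrite /F uU.
- move=> u u' uU u'U fu; apply/eqP; apply: contraT => uu'.
  case: (leqP (size_of u) (size_of u')) => [le|/ltnW le].
    by move: (nE (inr (u, u'))) => /=; rewrite /active_uu /= uU u'U uu' le inE fu eqxx.
  move: (nE (inr (u', u))) => /=.
  by rewrite /active_uu /= uU u'U eq_sym uu' le inE fu eqxx.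
- move=> w wW win; move: (nE (inl w)) => /=.
  by rewrite /active_w wW win inE -leqNgt.
Qed.

End LayerEmbedding.

(** * Embedding a graded digraph *)

Section Graded.
Variables (V : finType) (e : rel V) (H : nat) (P : nat -> {set V}).
Hypothesis graded_eP : graded_partition e H P.

Lemma layer_unique i j v : 1 <= i <= H -> 1 <= j <= H ->
  v \in P i -> v \in P j -> i = j.
Proof.
case: graded_eP => _ dis _ iH jH vi vj; apply/eqP; apply: contraT => /eqP ij.
by rewrite (disjointFr (dis i j iH jH ij) vi) in vj.
Qed.

Lemma in_neighbour_layer i u v : 1 <= i <= H -> v \in P i -> e u v ->
  1 < i /\ u \in P i.-1.
Proof.
move=> iH vi euv; case: graded_eP => _ _ /(_ u v euv) [j jH [uj vj]].
have -> : i = j.+1 by apply: (layer_unique iH _ vi vj); lia.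
by split=> //; lia.
Qed.

Lemma in_degree_layer i w : 1 <= i < H -> w \in P i.+1 ->
  in_degree e w <= layer_max_in_degree e H P i.
Proof.
move=> iH wi; rewrite /layer_max_in_degree iH /max_in_degree.
have wS : w \in P i :|: P i.+1 by rewrite inE wi orbT.
apply: leq_trans (leq_bigmax (Sub w wS)).
rewrite /in_degree -(card_imset _ val_inj).
apply/subset_leq_card/subsetP => u; rewrite inE => euw.
have [//|_ ui] := @in_neighbour_layer i.+1 u w _ wi euw; first lia.
have uS : u \in P i :|: P i.+1 by rewrite inE ui.
by apply/imsetP; exists (Sub u uS); rewrite ?inE.
Qed.

Lemma layer_max_in_degree_le i : layer_max_in_degree e H P i <= max_in_degree e.
Proof.
rewrite /layer_max_in_degree; case: ifP => // _.
apply/bigmax_leqP => w _; apply: leq_trans (leq_bigmax (val w)).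
rewrite /in_degree -(card_imset _ val_inj).
apply/subset_leq_card/subsetP => _ /imsetP [u + ->].
by rewrite !inE.
Qed.

Definition non_sources i : {set V} := [set v in P i | 0 < in_degree e v].
Definition sources i : {set V} := [set v in P i | ~~ (0 < in_degree e v)].

Lemma card_layer i : #|P i| = #|non_sources i| + #|sources i|.
Proof.
rewrite -(cardsID [set v | 0 < in_degree e v] (P i)); congr (_ + _).
  by apply: eq_card => v; rewrite !inE.
by apply: eq_card => v; rewrite !inE andbC.
Qed.

(* Consecutive parts without edges between them are treated as if their in-degree
   were [1], which costs a constant factor and avoids degenerate cases. *)
Definition degree_bound i := maxn 1 (layer_max_in_degree e H P i).

Section Embedding.
Variables (a k : nat -> nat) (d K : nat).

(* The length of the interval from which the image of layer [i] is extracted;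
   sources have full lists, hence no factor [2 ^ a i.-1] for them. *)
Definition reservoir i := 2 ^ (k i + 2) *
  (64 * max_in_degree e * (2 ^ a i.-1 * #|non_sources i| + #|sources i|)).

Hypothesis max_in_gt0 : 0 < max_in_degree e.
Hypothesis max_out_le : 8 * max_out_degree e <= 2 ^ d.
Hypothesis K_gt0 : 0 < K.
Hypothesis k_le : forall i, 1 <= i <= H -> 2 * k i <= K.
Hypothesis a_ge : forall i, 1 <= i <= H ->
  (k i).+1 * degree_bound i + 1 + (degree_bound i * a i.-1 + (degree_bound i + d))
  <= a i * k i.

Lemma reservoir_gt0 i v : v \in P i -> 0 < reservoir i.
Proof.
move=> vi; have : 0 < #|P i| by rewrite (cardD1 v) vi.
rewrite card_layer addn_gt0 /reservoir !muln_gt0 expn_gt0 max_in_gt0 /=.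
by rewrite addn_gt0 muln_gt0 expn_gt0.
Qed.

Lemma graded_embedding (T : finType) (r : rel T) : tournament r ->
  K.+1 * (1 + \sum_(1 <= i < H.+1) reservoir i) <= #|T| -> contains_copy e r.
Proof.
move=> /median_order [o [o_uniq szo o_med]]; rewrite -szo => big_o.
have s_gt0 i : 0 < degree_bound i by rewrite leq_max.
have [B BP] := chain o_uniq o_med K_gt0 s_gt0 k_le a_ge big_o.
(* [f] is total, but only its values on the first [n] layers matter. The last clause looks ahead: it
   keeps the candidate lists of layer [n.+1] dense in [B n.+1]. *)
suff state n : n <= H -> exists f : V -> T,
  [/\ forall j v, 1 <= j <= n -> v \in P j -> f v \in B j,
      forall i j u v, 1 <= i <= n -> 1 <= j <= n -> u \in P i -> v \in P j ->
        f u = f v -> u = v,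
      forall j u v, 1 <= j <= n -> v \in P j -> e u v -> r (f u) (f v)
    & forall w, n < H -> w \in P n.+1 -> 0 < in_degree e w ->
      #|B n.+1| <= #|common_out r (B n.+1) (f @: [set u | e u w])| * 2 ^ a n].
  have [cover _ _] := graded_eP.
  have [f [_ injf homf _]] := state H (leqnn H).
  exists f => [u v|u v].
    by have [i iH ui] := cover u; have [j jH vj] := cover v; apply: (injf i j).
  by have [j jH vj] := cover v; apply: (homf j).
elim: n => [|n IH] leH.
  have [x0 _] : exists x, x \in o.
    case: (o) big_o => [|x o'] /=; first by lia.
    by exists x; rewrite inE eqxx.
  exists (fun=> x0); split; try by move=> j; lia.
  move=> w H0 wP; rewrite /in_degree card_gt0 => /set0Pn [u]; rewrite inE => euw.
  by have [] := @in_neighbour_layer 1 u w _ wP euw; lia.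
have [f [fB injf homf denf]] := IH (ltnW leH).
set i := n.+1 in leH *.
have iH : 1 <= i <= H by rewrite leH.
(* [chain] gives no information on a layer with empty reservoir. If [P i] is empty, then layer
   [i.+1] has only sources and [f] can be kept. *)
have [P0|[v0 v0P]] := set_0Vmem (P i).
  have levn j v : 1 <= j <= i -> v \in P j -> 1 <= j <= n.
    move=> ji; have [->|//] : j = i \/ 1 <= j <= n by move: ji; rewrite /i; lia.
    by rewrite P0 inE.
  exists f; split.
  - by move=> j v /levn jn vj; apply: (fB j) => //; apply: jn vj.
  - move=> j l u v /levn jn /levn ln uj vl; apply: (injf j l) => //.
      exact: jn uj.
    exact: ln vl.
  - by move=> j u v /levn jn vj; apply: (homf j) => //; apply: jn vj.
  - move=> w ltH wP; rewrite /in_degree card_gt0 => /set0Pn [u]; rewrite inE => euw.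
    have [|_] := @in_neighbour_layer i.+1 u w _ wP euw; first by lia.
    by rewrite /= P0 inE.
have mi := reservoir_gt0 v0P.
have [szB disB badB] := BP i iH mi.
set S := max_in_degree e.
have szB' : 64 * S * (2 ^ a n * #|non_sources i| + #|sources i|) <= #|B i|.
  by move: szB; rewrite /reservoir leq_pmul2l ?expn_gt0.
have B0 : 0 < #|B i| by case: #|B i| szB mi => //; lia.
pose W := if i < H then P i.+1 else set0.
pose L u := common_out r (B i) (f @: [set z | e z u]).
have Lsub u : u \in P i -> L u \subset B i by move=> _; apply: common_out_sub.
have Lsrc u : in_degree e u = 0 -> L u = B i.
  by move/eqP; rewrite /in_degree cards_eq0 /L => /eqP ->; rewrite imset0 common_out0.
have Lden u : u \in P i -> #|B i| <= 2 ^ a n * #|L u|.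
  move=> uP; case: (posnP (in_degree e u)) => [/Lsrc ->|in0].
    by rewrite leq_pmull // expn_gt0.
  by rewrite mulnC; apply: denf.
have Win w : w \in W -> i < H /\ w \in P i.+1.
  by rewrite /W; case: ifP; rewrite ?inE.
have W_sub w : w \in W -> [set u | e u w] \subset P i.
  move=> /Win [iH' wP]; apply/subsetP => u; rewrite inE => euw.
  by have [|_] := @in_neighbour_layer i.+1 u w _ wP euw; first by lia.
have W_le w : w \in W -> in_degree e w <= degree_bound i.
  move=> /Win [iH' wP]; rewrite leq_max; apply/orP; right.
  exact: in_degree_layer.
have s_le : 0 < degree_bound i <= S.
  by rewrite s_gt0 geq_max max_in_gt0 layer_max_in_degree_le.
have out_le u : out_degree e u <= max_out_degree e by apply: leq_bigmax.
(* The maximum with 1 keeps the denominators of the local lemma positive when one of the two classes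
   is empty. *)
pose x := maxn 1 (64 * S * #|non_sources i|).
pose y := maxn 1 (64 * S * #|sources i|).
have x0 : 0 < x by rewrite leq_max.
have y0 : 0 < y by rewrite leq_max.
have L_ge u : u \in P i -> (if 0 < in_degree e u then x else y) <= #|L u|.
  move=> uP; case: ifP => [in0|/negbT nin].
    have u1 : 0 < #|non_sources i| by rewrite (cardD1 u) inE uP in0.
    have -> : x = 64 * S * #|non_sources i|.
      by apply/maxn_idPr; rewrite !muln_gt0 max_in_gt0.
    have := Lden u uP; rewrite -(leq_pmul2l (expn_gt0 2 (a n))); nia.
  have u1 : 0 < #|sources i| by rewrite (cardD1 u) inE uP nin.
  have -> : y = 64 * S * #|sources i| by apply/maxn_idPr; rewrite !muln_gt0 max_in_gt0.
  by rewrite Lsrc; [lia | move: nin; case: (in_degree e u)].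
have few w : w \in W -> bad_tuples r (B i.+1) (a i) (B i) (degree_bound i) set0 *
    2 ^ (degree_bound i * a n + (degree_bound i + d)) <= #|B i| ^ degree_bound i.
  by move=> /Win [iH' /reservoir_gt0 mi1]; apply: badB.
have [g [gL injg deng]] := layer_embedding B0 Lsub Lden s_le W_sub W_le out_le
  max_out_le x0 y0 (leq_maxr _ _) (leq_maxr _ _) L_ge few.
have offi j v : 1 <= j <= n -> v \in P j -> v \notin P i.
  move=> jn vj; apply/negP => vi.
  by have : j = i; [apply: (layer_unique _ iH vj vi); lia | rewrite /i; lia].
pose f' v := if v \in P i then g v else f v.
have f'i v : v \in P i -> f' v = g v by rewrite /f' => ->.
have f'j j v : 1 <= j <= n -> v \in P j -> f' v = f v.
  by move=> jn vj; rewrite /f' (negbTE (offi j v jn vj)).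
have split_i j : 1 <= j <= i -> j = i \/ 1 <= j <= n by rewrite /i; lia.
have gB v : v \in P i -> g v \in B i.
  by move=> vi; apply: (subsetP (Lsub v vi)); apply: gL.
have f'B j v : 1 <= j <= i -> v \in P j -> f' v \in B j.
  move=> /split_i [->|jn] vj; first by rewrite f'i ?gB.
  by rewrite (f'j j) ?fB.
exists f'; split=> //.
- move=> j l u v /[dup] ji /split_i jP /[dup] li /split_i lP uj vl fuv.
  have [jl|/eqP jl] := eqVneq j l.
    rewrite -{}jl in li lP vl; case: jP => [ji'|jn].
      rewrite ji' in uj vl; move: fuv; rewrite !f'i //; exact: injg.
    by move: fuv; rewrite !(f'j j) //; apply: (injf j j).
  have jH : 1 <= j <= H by lia.
  have lH : 1 <= l <= H by lia.
  have [_ dis _] := BP j jH (reservoir_gt0 uj).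
  have := disjointFr (dis l lH (reservoir_gt0 vl) jl) (f'B j u ji uj).
  by rewrite fuv f'B.
- move=> j u v /[dup] ji /split_i [jE|jn] vj euv.
    rewrite {}jE in ji vj; have [n0 un] := in_neighbour_layer iH vj euv.
    rewrite (f'i v) // (f'j n u) //; last by move: n0; rewrite /i; lia.
    have := gL v vj; rewrite inE => /andP [_ /forall_inP]; apply.
    by apply: imset_f; rewrite inE.
  have jH : 1 <= j <= H by lia.
  have [j1 uj] := in_neighbour_layer jH vj euv.
  by rewrite (f'j j v) // (f'j j.-1 u) //; [apply: (homf j) | lia].
- move=> w iH' wP win.
  have wW : w \in W by rewrite /W iH'.
  have -> : f' @: [set u | e u w] = g @: [set u | e u w].
    by apply: eq_in_imset => u /(subsetP (W_sub w wW)) /f'i.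
  exact: deng.
Qed.

End Embedding.
End Graded.

(** * Choice of the parameters *)

(** The least unavoidable number is found classically, since [unavoidable_at] quantifies over all
    finite types. *)
Lemma oriented_ramsey_le (V : finType) (e : rel V) (N : nat) :
  unavoidable_at e N -> exists2 r, is_oriented_ramsey e r & r <= N.
Proof.
elim/ltn_ind: N => N IH UN.
have [[n [ltnN Un]]|none] := classic (exists n, n < N /\ unavoidable_at e n).
  by have [r rP le] := IH n ltnN Un; exists r => //; apply: leq_trans le (ltnW ltnN).
exists N => //; split=> // n Un; rewrite leqNgt; apply/negP => ltnN.
by apply: none; exists n.
Qed.

Lemma pow2_between (n : nat) : 0 < n -> exists2 d, 8 * n <= 2 ^ d & 2 ^ d <= 16 * n.
Proof.
move=> n0; have n1 : 1 < 8 * n by lia.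
have /andP [lo hi] := up_log_bounds (ltnSn 1) n1.
exists (up_log 2 (8 * n)) => //; move: lo hi.
by case: (up_log 2 (8 * n)) => [|m] /=; rewrite ?expn0 ?expnS; lia.
Qed.

Section RamseyBound.
Variables (V : finType) (e : rel V) (H : nat) (P : nat -> {set V}).
Hypothesis graded_eP : graded_partition e H P.
Hypothesis has_edge : exists u v : V, e u v.

Let S := max_in_degree e.
Let D := max_out_degree e.
Let s := degree_bound e H P.
Let n1 i := #|non_sources e P i|.
Let n0 i := #|sources e P i|.

Definition ramsey_weight : nat :=
  \sum_(1 <= i < H.+1)
    2 ^ (2 * (layer_max_in_degree e H P i.-1 + layer_max_in_degree e H P i)) * #|P i|.

Lemma max_in_degree_gt0 : 0 < S.
Proof.
have [u [v euv]] := has_edge; apply: leq_trans (leq_bigmax v).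
by rewrite /in_degree card_gt0; apply/set0Pn; exists u; rewrite inE.
Qed.

Lemma max_out_degree_gt0 : 0 < D.
Proof.
have [u [v euv]] := has_edge; apply: leq_trans (leq_bigmax u).
by rewrite /out_degree card_gt0; apply/set0Pn; exists v; rewrite inE.
Qed.

Lemma ramsey_weight_gt0 : 0 < ramsey_weight.
Proof.
have [u _] := has_edge; have [cover _ _] := graded_eP.
have [i iH ui] := cover u; rewrite /ramsey_weight.
rewrite (big_cat_nat (n := i)) /=; [|lia|lia].
rewrite addn_gt0; apply/orP; right.
rewrite big_ltn; last by lia.
by rewrite addn_gt0 muln_gt0 expn_gt0 (cardD1 u) ui.
Qed.

Lemma degree_bound_bounds i : 0 < s i <= S.
Proof.
by rewrite /s /degree_bound leq_max geq_max max_in_degree_gt0 layer_max_in_degree_le.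
Qed.

(** Non-sources lie in the union of the out-neighbourhoods of the previous layer; the factor
    [(1 < i)] records that layer 1 has none. *)
Lemma card_non_sources i : 1 <= i <= H -> n1 i <= (1 < i) * (D * #|P i.-1|).
Proof.
move=> iH; rewrite /n1.
have sub : non_sources e P i \subset \bigcup_(u in P i.-1 | 1 < i) [set v | e u v].
  apply/subsetP => v; rewrite inE => /andP [vi].
  rewrite /in_degree card_gt0 => /set0Pn [u]; rewrite inE => euv.
  have [i1 ui] := in_neighbour_layer graded_eP iH vi euv.
  by apply/bigcupP; exists u; rewrite ?ui ?inE.
apply: leq_trans (subset_leq_card sub) _.
case: (1 < i); last first.
  by rewrite big_pred0 ?cards0 // => u; rewrite andbF.
rewrite mul1n mulnC -sum_nat_const.
rewrite (eq_bigl (fun u => u \in P i.-1)); last by move=> u; rewrite andbT.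
elim/big_ind2: _ => [|m1 A1 m2 A2 le1 le2|u _]; rewrite ?cards0 //.
  exact: leq_trans (leq_card_setU _ _) (leq_add le1 le2).
exact: leq_bigmax.
Qed.

Lemma unavoidable_of_parameters (a k : nat -> nat) (d K : nat) :
  8 * D <= 2 ^ d -> 0 < K -> K.+1 <= 45 * S ->
  (forall i, 1 <= i <= H -> 2 * k i <= K) ->
  (forall i, 1 <= i <= H ->
    (k i).+1 * s i + 1 + (s i * a i.-1 + (s i + d)) <= a i * k i) ->
  \sum_(1 <= i < H.+1) 2 ^ k i * (2 ^ a i.-1 * n1 i + n0 i)
    <= 1280 * D * ramsey_weight ->
  unavoidable_at e (10 ^ 9 * S ^ 2 * D * ramsey_weight).
Proof.
move=> Dd K0 KS kK ak sum T r cardT tour.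
apply: (graded_embedding graded_eP max_in_degree_gt0 Dd K0 kK ak tour).
have -> : \sum_(1 <= i < H.+1) reservoir e P a k i
    = 256 * S * \sum_(1 <= i < H.+1) 2 ^ k i * (2 ^ a i.-1 * n1 i + n0 i).
  rewrite big_distrr; apply: eq_bigr => i _ /=.
  rewrite /reservoir -/S -/(n1 i) -/(n0 i) expnD.
  by move: (2 ^ k i) (2 ^ a i.-1 * n1 i + n0 i) => u v; lia.
have S0 := max_in_degree_gt0; have D0 := max_out_degree_gt0.
have w0 := ramsey_weight_gt0.
move: sum; set Q := \sum_(1 <= i < H.+1) _ => sum.
rewrite cardT; set w := ramsey_weight in sum w0 *.
have X0 : 0 < S * (D * w) by rewrite !muln_gt0 S0 D0.
(* The factor 256 is the [4 * 64] of [reservoir]; doubling it absorbs the additive 1. *)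
have le : 1 + 256 * S * Q <= 512 * (1280 * (S * (D * w))).
  have : 256 * S * Q <= 256 * (1280 * (S * (D * w))).
    rewrite -mulnA leq_mul2l /= [1280 * _]mulnCA leq_mul2l.
    by apply/orP; right; apply: leq_trans sum _; rewrite mulnA.
  by move: (S * (D * w)) (256 * S * Q) X0 => X Y; lia.
apply: leq_trans (leq_mul KS le) _.
have : 45 * (512 * 1280) <= 10 ^ 9.
  (* Comparing factor by factor avoids evaluating [10 ^ 9] in unary. *)
  have [h1 [h2 h3]] : 45 <= 10 ^ 2 /\ 512 <= 10 ^ 3 /\ 1280 <= 10 ^ 4 by [].
  by rewrite -[9]/(2 + (3 + 4)) !expnD; exact: (leq_mul h1 (leq_mul h2 h3)).
rewrite -mulnn -(leq_pmul2r (_ : 0 < S * (S * (D * w)))); last by rewrite muln_gt0 S0.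
by move: (10 ^ 9) => N; apply: etrans; congr (_ <= _); lia.
Qed.

Lemma ramsey_bound : unavoidable_at e (10 ^ 9 * S ^ 2 * D * ramsey_weight).
Proof.
have S0 := max_in_degree_gt0; have D0 := max_out_degree_gt0.
have [d dlo dhi] := pow2_between D0.
have d1 : 0 < d by case: (d) dlo => //; rewrite expn0; lia.
have cardP i : n1 i + n0 i = #|P i| by rewrite /n1 /n0 -card_layer.
have [d_small|d_large] := leqP d (20 * S); last first.
  (* With [k = 10 * S], raising [a] by [c] gains at least [9 * S * c >= d] in the recursive
     inequality. The total exponent [12 * S + c] stays below [d], and [2^d] is at most [16 * D]. *)
  pose c := (d %/ (9 * S)).+1.
  have dc : d <= 9 * S * c.
    by rewrite mulnC; apply/ltnW/ltn_ceil; lia.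
  have c_le : c <= (d %/ 9).+1.
    by rewrite ltnS leq_div2l //; lia.
  apply: (@unavoidable_of_parameters (fun=> 2 * S + c) (fun=> 10 * S) d (20 * S)) => //.
  - by lia.
  - by lia.
  - by move=> i _; lia.
  - move=> i _; have /andP [s0 sS] := degree_bound_bounds i; nia.
  rewrite /ramsey_weight [X in _ <= X]big_distrr; apply: leq_sum => i _ /=.
  apply: (@leq_trans (2 ^ d * #|P i|)).
    rewrite -cardP.
    apply: (@leq_trans (2 ^ (10 * S) * (2 ^ (2 * S + c) * (n1 i + n0 i)))).
      by rewrite leq_mul2l mulnDr leq_add2l leq_pmull ?expn_gt0 ?orbT.
    rewrite mulnA -expnD leq_mul2r leq_pexp2l ?orbT //; lia.
  apply: leq_trans (leq_mul dhi (leqnn _)) _.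
  by rewrite mulnA leq_mul2r; apply/orP; right; have := expn_gt0 2 (2 *
    (layer_max_in_degree e H P i.-1 + layer_max_in_degree e H P i)); nia.
pose a i := s i + minn (s i) (s i.-1) + 2.
pose k i := maxn (2 * s i + d) (a i.-1).
pose F i := 2 ^ (2 * (s i.-1 + s i)) * #|P i|.
have a_le i : a i <= 2 * s i + 2 by rewrite /a; lia.
(* Since [d <= 20 * S], every [k i] is at most [22 * S]. *)
apply: (@unavoidable_of_parameters a k d (44 * S)) => //.
- by lia.
- by lia.
- move=> i _; have := a_le i.-1; move: d_small S0; rewrite /k.
  have := degree_bound_bounds i; have := degree_bound_bounds i.-1.
  by move: (a i.-1) (s i) (s i.-1) S => x y z w; lia.
- move=> i _; have := a_le i.-1; have /andP [s0 _] := degree_bound_bounds i.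
  have : 2 * s i + d <= k i /\ a i.-1 <= k i by rewrite /k; lia.
  have -> : a i = s i + minn (s i) (s i.-1) + 2 by [].
  move: (k i) (a i.-1) (s i) (s i.-1) s0 => x y z t z0 [zx yx] yt.
  (* The term to absorb is [s i * a i.-1]. If [s i <= s i.-1], it is at most [s i * k i]. Otherwise
     [a i.-1 <= 2 * s i.-1 + 2] bounds it, and [(s i.-1 + 2) * k i] suffices because
     [k i >= 2 * s i + d]. *)
  case: (leqP z t) => zt.
    have := leq_mul (leqnn z) yx; nia.
  have := leq_mul (leqnn z) yt; have := leq_mul (leqnn t) zx; nia.
have term i : 1 <= i <= H ->
    2 ^ k i * (2 ^ a i.-1 * n1 i + n0 i) <= 64 * D * F i + (1 < i) * (16 * D * F i.-1).
  move=> iH; have nP := card_non_sources iH.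
  have ai := a_le i.-1.
  have n0P : n0 i <= #|P i| by rewrite -cardP leq_addl.
  case: (leqP (a i.-1) (2 * s i + d)) => ka.
    have -> : k i = 2 * s i + d by apply/maxn_idPl.
    apply: (@leq_trans (64 * D * F i)); last exact: leq_addr.
    apply: (@leq_trans (2 ^ (2 * s i + d) * (2 ^ a i.-1 * (n1 i + n0 i)))).
      by rewrite leq_mul2l mulnDr leq_add2l leq_pmull ?expn_gt0 ?orbT.
    rewrite cardP /F !mulnA leq_mul2r; apply/orP; right.
    rewrite -expnD; apply: (@leq_trans (2 ^ (2 * (s i.-1 + s i) + 2 + d))).
      by rewrite leq_pexp2l //; lia.
    by rewrite !expnD; move: dhi; move: (2 ^ d) (2 ^ (2 * (s i.-1 + s i))) => u v; nia.
  have -> : k i = a i.-1 by apply/maxn_idPr/ltnW.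
  (* Sources stay with layer [i]. Non-sources carry [2^(2 * a i.-1)] and are charged to layer
     [i.-1]; the minimum in the definition of [a] bounds this exponent by
     [2 * (s i.-1.-1 + s i.-1) + 4]. *)
  rewrite mulnDr addnC; apply: leq_add.
    apply: (@leq_trans (2 ^ (2 * (s i.-1 + s i) + 2) * #|P i|)).
      by apply: leq_mul => //; rewrite leq_pexp2l //; lia.
    rewrite /F expnD mulnAC mulnC leq_mul2r; apply/orP; right; lia.
  rewrite mulnA -expnD; apply: leq_trans (leq_mul (leqnn _) nP) _.
  case: (1 < i); last by rewrite !mul0n muln0.
  rewrite !mul1n /F.
  have -> : 16 * D * (2 ^ (2 * (s i.-1.-1 + s i.-1)) * #|P i.-1|)
      = 2 ^ (2 * (s i.-1.-1 + s i.-1) + 4) * (D * #|P i.-1|).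
    by rewrite expnD; lia.
  by rewrite leq_mul2r leq_pexp2l ?orbT // /a; lia.
apply: (@leq_trans (\sum_(1 <= i < H.+1)
    (64 * D * F i + (1 < i) * (16 * D * F i.-1)))).
  rewrite !big_nat; apply: leq_sum => i iH; apply: term; lia.
rewrite big_split /=.
have shift : \sum_(1 <= i < H.+1) (1 < i) * (16 * D * F i.-1)
    <= \sum_(1 <= i < H.+1) 16 * D * F i.
  case: (H) => [|h]; first by rewrite !big_geq.
  rewrite big_ltn // mul0n add0n big_add1 /= [X in _ <= X]big_nat_recr //=.
  apply: leq_trans (leq_addr _ _); rewrite !big_nat; apply: leq_sum => i iH.
  by case/andP: iH => i1 _; rewrite ltnS i1 mul1n.
apply: leq_trans (leq_add (leqnn _) shift) _.
rewrite -!big_distrr /= -mulnDl -mulnDl /ramsey_weight.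
(* Here 80 is [64 + 16]. Replacing [s] by the true layer degrees, which are smaller by at most 1,
   changes each exponent by at most 4, hence the factor 16. *)
apply: (@leq_trans (80 * D * (16 * ramsey_weight))); last first.
  by rewrite mulnCA !mulnA leq_mul2r; lia.
rewrite leq_mul2l; apply/orP; right.
rewrite /ramsey_weight [X in _ <= X]big_distrr; apply: leq_sum => i _ /=.
rewrite /F mulnA leq_mul2r; apply/orP; right.
rewrite (_ : 16 = 2 ^ 4) // -expnD leq_pexp2l //.
rewrite /s /degree_bound; lia.
Qed.

End RamseyBound.

(** Without an edge both maximum degrees are 0 and the right-hand side vanishes, whereas the Ramsey
    number of an edgeless digraph is its number of vertices; this is why [has_edge] is assumed. *)
Theorem theorem3p1 (V : finType) (e : rel V) (H : nat) (P : nat -> {set V})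
    (graded_eP : graded_partition e H P)
    (has_edge : exists u v : V, e u v) :
  exists2 r : nat, is_oriented_ramsey e r &
    r <= 10 ^ 9 * max_in_degree e ^ 2 * max_out_degree e *
      \sum_(1 <= i < H.+1)
        2 ^ (2 * (layer_max_in_degree e H P i.-1 + layer_max_in_degree e H P i))
        * #|P i|.
Proof. exact/oriented_ramsey_le/ramsey_bound. Qed.
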